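(* Let $\gamma=(\gamma_i)_{i\ge0}$ be a sequence of i.i.d. positive random variables with $\mathbb{E}|\log\gamma_0|<+\infty$. Let $G$ be the group of lower triangular matrices in $SL_2(\mathbb{R})$, and for $n\ge1$ put $$N_n(\gamma)=\sum_{k=0}^{n-1}\gamma_k^{-1}\Big(\prod_{i=0}^{k-1}\gamma_i^{-1}\Big)^2,\qquad \widetilde N_n(\gamma^{-1})=\sum_{k=0}^{n-1}\gamma_k^{-1}\Big(\prod_{j=k+1}^{n-1}\gamma_j^{-1}\Big)^2 .$$ Assume that $\mathbb{E}(\log\gamma_0)>0$ and that the law on $G$ of the random matrix $g_0=\begin{pmatrix} \gamma_0 & 0 \\ 1 & \gamma_0^{-1} \end{pmatrix}$ is spread-out. Then $(N_n(\gamma))_{n\ge1}$ converges almost surely, and the law of $N_\infty(\gamma):=\lim_{n\to+\infty}N_n(\gamma)$ is equal to the unique invariant probability measure of the Markov chain $(\widetilde N_n(\gamma^{-1}))_{n\ge1}$.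
   Context: Empty products equal $1$. A probability measure $\mu$ on $G$ is spread-out if there is an integer $p\geq 1$ such that the $p$-fold convolution power $\mu^{*p}$ is not singular with respect to a Haar measure on $G=\left\{\begin{pmatrix} x & 0 \\ z & x^{-1} \end{pmatrix}: x\in\mathbb{R}\setminus\{0\},\ z\in\mathbb{R}\right\}$. The process $(\widetilde N_n(\gamma^{-1}))_{n\ge1}$ satisfies $\widetilde N_n(\gamma^{-1})=\gamma_{n-1}^{-2}\,\widetilde N_{n-1}(\gamma^{-1})+\gamma_{n-1}^{-1}$ for $n\ge2$; it is viewed as a Markov chain on $\mathbb{R}$ with one-step transition $x\mapsto\gamma_0^{-2}x+\gamma_0^{-1}$. A probability measure $\nu$ on $\mathbb{R}$ is invariant if, for $Y\sim\nu$ independent of $\gamma_0$, $\gamma_0^{-2}Y+\gamma_0^{-1}\sim\nu$. With $X_n=\prod_{i=0}^{n-1}\gamma_i$ and $Z_n=\sum_{k=0}^{n-1}\big(\prod_{i<k}\gamma_i^{-1}\big)\big(\prod_{k<j\le n-1}\gamma_j\big)$ one has $N_n(\gamma)=X_n^{-1}Z_n$, and $\widetilde N_n(\gamma^{-1})$ is the quantity $X_nZ_n$ computed with the sequence $(\gamma_i^{-1})_{i\geq 0}$ in place of $(\gamma_i)_{i\geq 0}$. *)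

(* Defs.v *)
From HB Require Import structures.
From mathcomp Require Import all_boot all_order all_algebra finmap.
From mathcomp Require Import all_classical all_reals all_analysis.

Set Implicit Arguments.
Unset Strict Implicit.
Unset Printing Implicit Defensive.
Import Order.TTheory GRing.Theory Num.Theory.
Import numFieldNormedType.Exports.
Local Open Scope classical_set_scope.
Local Open Scope ring_scope.

Section perpetuities.
Context {R : realType}.
Implicit Types (u : nat -> R) (n : nat).

Definition Nsum u n : R :=
  \sum_(0 <= k < n) (u k)^-1 * (\prod_(0 <= i < k) (u i)^-1) ^+ 2.

(* [Ntilde_inv u] is the sequence $\widetilde N(u^{-1})$: the inversion of
   [u] is part of the definition. *)
Definition Ntilde_inv u n : R :=
  \sum_(0 <= k < n) (u k)^-1 * (\prod_(k.+1 <= j < n) (u j)^-1) ^+ 2.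

Definition affine_step (a x : R) : R := a ^- 2 * x + a^-1.

End perpetuities.

Section independence.
Local Open Scope ereal_scope.
Context d (T : measurableType d) (R : realType) (P : probability T R).
Implicit Types X : nat -> {RV P >-> R}.

Definition mutually_independent X : Prop :=
  forall (J : {fset nat}) (B : nat -> set R),
    (forall i, measurable (B i)) ->
    P (\bigcap_(i in [set` J]) (X i @^-1` B i)) =
    (\prod_(i <- J) fine (P (X i @^-1` B i)))%:E.

Definition identically_distributed X : Prop :=
  forall i (A : set R), measurable A ->
    distribution P (X i) A = distribution P (X 0%N) A.

Definition iid X : Prop := mutually_independent X /\ identically_distributed X.

End independence.

Section random_iterations.
Context d (T : measurableType d) (R : realType) (P : probability T R).

(* When the [xi n] are i.i.d., such a process started from a function of
   [xi 0] is a Markov chain on [R], with transition kernel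
   Q(x, A) = P (F (xi 0) x \in A). *)
Definition driven_by (F : R -> R -> R) (xi Y : nat -> T -> R) : Prop :=
  forall n w, (0 < n)%N -> Y n.+1 w = F (xi n w) (Y n w).

(* The product measure is the law of a pair (xi0, Y) with Y ~ nu independent
   of xi0, so that the left-hand side is the law of F xi0 Y. *)
Definition invariant_law (F : R -> R -> R) (xi0 : {RV P >-> R})
    (nu : probability R R) : Prop :=
  forall A : set R, measurable A ->
    pushforward (distribution P xi0 \x nu)%E (fun u => F u.1 u.2) A = nu A.

(* The law nu is the one and only invariant probability measure. Measures are
   compared on measurable sets, as their values elsewhere are junk. *)
Definition unique_invariant_law (F : R -> R -> R) (xi0 : {RV P >-> R})
    (nu : probability R R) : Prop :=
  invariant_law F xi0 nu /\
  forall nu' : probability R R, invariant_law F xi0 nu' ->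
    forall A : set R, measurable A -> nu' A = nu A.

End random_iterations.

(* The group G is handled as a closed subset of the 2 x 2 matrices, and a
   measure on G as a Borel measure on the matrices that vanishes off G. *)
Notation borel_mx R := (g_sigma_algebraType (@open 'M[R]_2)).

Section lower_triangular_group.
Context (R : realType).

Definition LTSL2 : set 'M[R]_2 :=
  [set g : 'M[R]_2 | g 0 1 = 0 /\ \det g = 1].

Local Open Scope ereal_scope.

(* Left Haar measures. No regularity condition is needed: G is locally compact
   and second countable. *)
Definition is_haar (lambda : {measure set (borel_mx R) -> \bar R}) : Prop :=
  [/\ lambda (~` LTSL2) = 0,
      lambda LTSL2 != 0,
      forall (g : 'M[R]_2) (A : set (borel_mx R)), LTSL2 g -> measurable A ->
        A `<=` LTSL2 -> lambda ((fun h : 'M[R]_2 => g *m h) @` A) = lambda A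
    & forall K : set 'M[R]_2, compact K -> K `<=` LTSL2 -> lambda K < +oo].

Definition conv (mu nu : set (borel_mx R) -> \bar R) (A : set (borel_mx R)) : \bar R :=
  \int[mu]_x nu [set y : (borel_mx R) | A ((x : 'M[R]_2) *m (y : 'M[R]_2))].

Definition conv_pow (mu : set (borel_mx R) -> \bar R) (p : nat) :
    set (borel_mx R) -> \bar R :=
  iter p (conv mu) (@dirac _ (borel_mx R) (1%:M : 'M[R]_2) R).

Definition mutually_singular (mu nu : set (borel_mx R) -> \bar R) : Prop :=
  exists A : set (borel_mx R), [/\ measurable A, mu A = 0 & nu (~` A) = 0].

Definition spread_out (mu : probability (borel_mx R) R) : Prop :=
  exists p : nat, (0 < p)%N /\
  exists lambda : {measure set (borel_mx R) -> \bar R},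
    is_haar lambda /\ ~ mutually_singular (conv_pow mu p) lambda.

End lower_triangular_group.

Section random_matrix.
Context (R : realType).

Definition gmat (a : R) : borel_mx R :=
  \matrix_(i < 2, j < 2)
    if (i == 0) && (j == 0) then a
    else if (i == 1) && (j == 0) then 1
    else if (i == 1) && (j == 1) then a^-1 else 0.

Lemma gmat_continuous (a : R) : a != 0 ->
  {for a, continuous (gmat : R -> 'M[R]_2)}.
Proof.
move=> a0; apply/cvg_ballP => e e0.
have Va : (b^-1 @[b --> a]) --> a^-1 by apply: cvgV => //; exact: cvg_id.
have na : \forall b \near a, ball a e b 
  by apply/nbhs_ballP; exists e.
have nV : \forall b \near a, ball a^-1 e b^-1 
  by apply: Va; apply/nbhs_ballP; exists e.
near=> b.
have ab : ball a e b by near: b.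
have Vab : ball a^-1 e b^-1 by near: b.
have bc (c : R) : ball c e c by exact: ballxx.
split=> // i j; rewrite !mxE.
by case: ifP => _ //; case: ifP => _ //; case: ifP.
Unshelve. all: by end_near. Qed.

Lemma measurable_gmat : measurable_fun [set: R] gmat.
Proof.
apply: (@measurability _ _ _ (borel_mx R) _ _ (@open 'M[R]_2)) => //.
move=> _ [U oU <-]; rewrite setTI.
rewrite (_ : _ @^-1` U = [set a | a != 0 /\ U (gmat a)] `|`
    (gmat @^-1` U `&` [set 0])).
  apply: measurableU.
    apply: measurable_realfun.open_measurable; rewrite openE => a /= [a0 Ua].
    have nU : \forall b \near a, U (gmat b).
      by apply: (gmat_continuous a0); exact: open_nbhs_nbhs.
    have n0 : \forall b \near a, b != 0.
      by apply: (@open_nbhs_nbhs _ a [set b : R | b != 0]); split => //;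
        exact: open_neq.
    by rewrite /interior; near=> b; split; near: b.
  have [U0|U0] := pselect (U (gmat 0)).
    rewrite (_ : _ `&` _ = [set 0]); first exact: measurable_set1.
    by apply/seteqP; split => x /= => [[]|->].
  rewrite (_ : _ `&` _ = set0); first exact: measurable0.
  by apply/seteqP; split => x //= [+ x0]; rewrite x0.
apply/seteqP; split => a /=.
  by move=> Ua; have [a0|a0] := eqVneq a 0; [right|left].
by move=> [[]|[]].
Unshelve. all: by end_near. Qed.

Context d (T : measurableType d) (P : probability T R).

Definition gmat_rv (X : {RV P >-> R}) (w : T) : borel_mx R := gmat (X w).

Lemma measurable_gmat_rv X : measurable_fun [set: T] (gmat_rv X).
Proof.
by apply: (measurableT_comp measurable_gmat); exact: measurable_funP.
Qed.

HB.instance Definition _ X :=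
  isMeasurableFun.Build _ _ _ _ (gmat_rv X) (measurable_gmat_rv X).

End random_matrix.

(* Main.v *)
Require Import Defs.
From HB Require Import structures.
From mathcomp Require Import all_boot all_order all_algebra finmap.
From mathcomp Require Import all_classical all_reals all_analysis.
From mathcomp Require Import measurable_realfun ring lra.
Set Implicit Arguments.
Unset Strict Implicit.
Unset Printing Implicit Defensive.
Import Order.TTheory GRing.Theory Num.Theory.
Import numFieldNormedType.Exports.
Local Open Scope classical_set_scope.
Local Open Scope ring_scope.

(* The k-th term of N_n is exp (- S_k - S_k.+1), where S is the random walk with
   steps ln gamma_i, so convergence only needs a linear lower bound on S. With m
   the mean of ln gamma_0, the walk with steps m / 2 - ln gamma_i has negative
   mean, and Garsia's maximal argument shows that it is almost surely bounded
   above. N_n is the backward iteration from 0 of the maps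
   x |-> gamma_i^-2 x + gamma_i^-1. Invariance of the limit law is read off
   N_infinity (gamma) = gamma_0^-2 N_infinity (shift gamma) + gamma_0^-1.
   Conversely, if nu is invariant, then the backward iterations started from an
   independent point of law nu all have law nu and converge almost surely to
   N_infinity, because the products of the gamma_i^-2 vanish; hence nu is the
   law of N_infinity. Independence enters only through the law L of the
   sequence gamma being the image of law(gamma_0) x L under concatenation. *)

(** * Sequences with the cylinder sigma-algebra, and concatenation of a head *)

Section sequence_space.
Context {R : realType}.

Definition cylinder (n : nat) (B : nat -> set R) : set (nat -> R) :=
  [set s | forall i, (i < n)%N -> B i (s i)].

Definition cylinders : set (set (nat -> R)) :=
  [set A | exists n B, (forall i, measurable (B i)) /\ A = cylinder n B].

Lemma setI_closed_cylinders : setI_closed cylinders.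
Proof.
move=> _ _ [m [B [mB ->]]] [n [C [mC ->]]].
pose D i := (if (i < m)%N then B i else setT) `&` 
            (if (i < n)%N then C i else setT).
exists (maxn m n), D; split.
  by move=> i; apply: measurableI; case: ifP.
apply/seteqP; split=> [s [Bs Cs] i _ /=|s Ds].
  by split; case: ifP => // lti; [exact: Bs|exact: Cs].
split=> i lti; have [] := Ds i; rewrite ?leq_max ?lti ?orbT //.
Qed.

Notation seq_space := (g_sigma_algebraType cylinders).

Lemma measurable_cylinder n B : (forall i, measurable (B i)) ->
  measurable (cylinder n B : set seq_space).
Proof. by move=> mB; apply: sub_sigma_algebra; exists n, B. Qed.

Lemma measurable_seq_spaceP {d} {T : measurableType d} (f : T -> seq_space) :
  (forall i, measurable_fun [set: T] (fun x => f x i)) ->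
  measurable_fun [set: T] f.
Proof.
move=> mf; apply: (@measurability _ _ _ seq_space _ _ cylinders) => //.
move=> _ [_ [n [B [mB ->]]] <-].
rewrite (_ : _ `&` _ = \bigcap_(i in `I_n) ((fun x => f x i) @^-1` B i)).
  apply: bigcap_measurableType => // i _.
  by rewrite -[_ @^-1` _]setTI; exact: mf.
by rewrite setTI.
Qed.

Lemma measurable_coord i : measurable_fun [set: seq_space] (fun s => s i).
Proof.
move=> _ B mB; rewrite setTI.
rewrite (_ : _ @^-1` B = cylinder i.+1 (fun j => if j == i then B else setT)).
  by apply: measurable_cylinder => j; case: ifP.
apply/seteqP; split=> [s /= Bs j _|s /(_ i (ltnSn i))]; last by rewrite eqxx.
by case: eqP => // ->.
Qed.

Definition seq_tail (s : seq_space) : seq_space := fun n => s n.+1.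

Definition seq_cons (u : R * seq_space) : seq_space :=
  fun n => if n is n'.+1 then u.2 n' else u.1.

Lemma measurable_seq_tail : measurable_fun [set: seq_space] seq_tail.
Proof. by apply: measurable_seq_spaceP => i; exact: measurable_coord. Qed.

Lemma measurable_seq_cons : measurable_fun [set: R * seq_space] seq_cons.
Proof.
apply: measurable_seq_spaceP => -[|i] /=; first exact: measurable_fst.
by apply: (measurableT_comp (measurable_coord i)); exact: measurable_snd.
Qed.

HB.instance Definition _ :=
  isMeasurableFun.Build _ _ _ _ seq_cons measurable_seq_cons.

Lemma seq_tail_cons u : seq_tail (seq_cons u) = u.2. Proof. by []. Qed.

(* [L] is the law of a sequence whose head has law [mu] and is independent of
   its tail, the tail having law [L] again. *)
Definition renewal_law (mu : probability R R) (L : probability seq_space R) :=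
  forall A, measurable A -> (mu \x L)%E (seq_cons @^-1` A) = L A.

Lemma preimage_cons_cylinder n B :
  seq_cons @^-1` cylinder n.+1 B = B 0%N `*` cylinder n (fun i => B i.+1).
Proof.
apply/seteqP; split=> [[x s] /= Bs|[x s] [/= Bx Bs] [|i]//]; last exact: Bs.
by split=> [|i ltin]; [exact: (Bs 0%N)|exact: (Bs i.+1)].
Qed.

(** Cylinders form a generating pi-system, and concatenation pulls a nonempty-length cylinder back
    to a rectangle, where the first factor of the product splits off. *)
Lemma product_law_renewal (mu : probability R R) (L : probability seq_space R) :
  (forall n B, (forall i, measurable (B i)) ->
     L (cylinder n B) = (\prod_(i < n) fine (mu (B i)))%:E) ->
  renewal_law mu L.
Proof.
move=> LE A mA.
apply: (@g_sigma_algebra_measure_unique _ R seq_space cylinders _ (fun=> setT)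
  _ _ (distribution (mu \x L)%E seq_cons) L) => //.
- by move=> ? [n [B [mB ->]]]; exact: measurable_cylinder.
- move=> i; exists 0%N, (fun=> setT); split=> //.
  by apply/seteqP; split.
- by rewrite bigcup_const.
- exact: setI_closed_cylinders.
- move=> _ [[|n] [B [mB ->]]].
    have -> : cylinder 0 B = [set: seq_space] by apply/seteqP; split.
    transitivity (1 : \bar R)%E; last exact/esym/probability_setT.
    exact: probability_setT.
  transitivity ((mu \x L)%E (seq_cons @^-1` cylinder n.+1 B)) => //.
  rewrite preimage_cons_cylinder.
  rewrite product_measure1E//; last exact: measurable_cylinder.
  apply: etrans (esym (LE _ _ mB)).
  rewrite big_ord_recl EFinM fineK ?fin_num_measure//; congr (_ * _)%E.
  by apply: LE => i; exact: mB.
- by move=> i; apply: le_lt_trans (ltry 1); exact: probability_le1.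
Qed.

End sequence_space.
Notation seq_space R := (g_sigma_algebraType (@cylinders R)).

(** * The law of an i.i.d. sequence *)

Section iid_law.
Context d (T : measurableType d) {R : realType} (P : probability T R).
Variable gamma : nat -> {RV P >-> R}.

Definition sample_path (w : T) : seq_space R := fun i => gamma i w.

Lemma measurable_sample_path : measurable_fun [set: T] sample_path.
Proof. by apply: measurable_seq_spaceP => i; exact: measurable_funP. Qed.

HB.instance Definition _ :=
  isMeasurableFun.Build _ _ _ _ sample_path measurable_sample_path.

(** Independence over the indices below n gives each cylinder a product mass, and equality in law
    turns every factor into one for [gamma 0]. *)
Lemma iid_renewal :
  iid gamma ->
  renewal_law (distribution P (gamma 0%N)) (distribution P sample_path).
Proof.
move=> [ind idd]; apply: product_law_renewal => n B mB.
have mem_J i : (i \in [fset i | i in iota 0 n]%fset) = (i < n)%N.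
  by rewrite !inE mem_iota.
have JE : perm_eq [fset i | i in iota 0 n]%fset (iota 0 n).
  by apply: uniq_perm => // [|i]; rewrite ?iota_uniq// mem_J mem_iota.
have := ind [fset i | i in iota 0 n]%fset B mB.
rewrite (_ : \bigcap_(i in _) _ = sample_path @^-1` cylinder n B); last first.
  apply/seteqP; split => w /= h i.
    by move=> ltin; apply: h; rewrite /= mem_J.
  by rewrite /= mem_J; exact: h.
move=> indJ; apply: (etrans indJ); congr EFin.
rewrite (perm_big _ JE)/= -[in LHS](subn0 n) big_mkord.
by apply: eq_bigr => i _; congr fine; exact: idd.
Qed.
End iid_law.

(** * Integrals along measure-preserving maps *)

Lemma measurable_preimage d d' (X : measurableType d) (Y : measurableType d')
    (phi : X -> Y) (A : set Y) :
  measurable_fun [set: X] phi -> measurable A -> measurable (phi @^-1` A).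
Proof. by move=> mphi mA; rewrite -[_ @^-1` _]setTI; exact: mphi. Qed.

Section measure_preserving.
Local Open Scope ereal_scope.
Context d d' (X : measurableType d) (Y : measurableType d') (R : realType).
Variables (m : {measure set X -> \bar R}) (m' : {measure set Y -> \bar R}).
Variable phi : X -> Y.
Hypothesis mphi : measurable_fun [set: X] phi.
Hypothesis phiE : forall A, measurable A -> m (phi @^-1` A) = m' A.

Lemma preserving_ge0_integral (D : set Y) (f : Y -> \bar R) :
  measurable D -> measurable_fun D f -> (forall y, D y -> 0 <= f y) ->
  \int[m']_(y in D) f y = \int[m]_(x in phi @^-1` D) f (phi x).
Proof.
move=> mD mf f0.
rewrite -(ge0_integral_pushforward mphi)//; last first.
  by move=> y; rewrite inE; exact: f0.
by apply: eq_measure_integral => A mA _; rewrite -phiE.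
Qed.

Lemma preserving_integrable (D : set Y) (f : Y -> \bar R) :
  measurable D -> m'.-integrable D f ->
  m.-integrable (phi @^-1` D) (fun x => f (phi x)).
Proof.
move=> mD /integrableP[mf foo]; apply/integrableP; split.
  apply: (measurable_comp mD) => //.
  - by move=> _ [x Dx <-].
  - exact: measurable_funTS.
rewrite -(@preserving_ge0_integral D (abse \o f))//.
  exact: measurableT_comp.
by move=> y _; exact: abse_ge0.
Qed.

End measure_preserving.

(** * Marginals of a product of two probabilities *)

Section product_probability.
Local Open Scope ereal_scope.
Context d d' (X : measurableType d) (Y : measurableType d') (R : realType).
Variables (m1 : probability X R) (m2 : probability Y R).

Lemma product_measure_fst A : measurable A -> (m1 \x m2) (fst @^-1` A) = m1 A.
Proof.
move=> mA; rewrite -setXT product_measure1E//.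
by rewrite -[RHS]mule1; congr (_ * _); exact: probability_setT.
Qed.

Lemma product_measure_snd A : measurable A -> (m1 \x m2) (snd @^-1` A) = m2 A.
Proof.
move=> mA; rewrite -setTX product_measure1E//.
by rewrite -[RHS]mul1e; congr (_ * _); exact: probability_setT.
Qed.

(** Integrand and event live on different factors, so Fubini separates them. In Garsia's argument
    this yields the mean step times the probability of unboundedness. *)
Lemma integral_fst_strip (f : X -> \bar R) A :
  measurable A -> m1.-integrable [set: X] f ->
  \int[m1 \x m2]_(u in snd @^-1` A) f u.1 = \int[m1]_x f x * m2 A.
Proof.
move=> mA intf.
have mfA : measurable (snd @^-1` A : set (X * Y)).
  by rewrite -[_ @^-1` _]setTI; exact: measurable_snd.
have intf1 : (m1 \x m2).-integrable (snd @^-1` A) (fun u => f u.1).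
  apply: (@integrableS _ _ _ _ [set: X * Y]) => //.
  apply: (@preserving_integrable _ _ _ _ _ (m1 \x m2) m1 fst _ _ setT f) => //.
  exact: product_measure_fst.
rewrite integral_mkcond -integral12_prod_meas1; last first.
  exact: (integrable_mkcond _ mfA).1.
rewrite -[m2 A]fineK ?fin_num_measure// -integralZr//.
apply: eq_integral => x _; rewrite fineK ?fin_num_measure// -integral_cst//.
rewrite [RHS]integral_mkcond; apply: eq_integral => y _.
by rewrite /patch; congr (if _ then _ else _); apply/idP/idP; rewrite !inE.
Qed.

End product_probability.

(** * Random walks with negative mean are bounded above *)

Section random_walk.
Context {R : realType} (mu : probability R R) (L : probability (seq_space R) R).
Hypothesis renL : renewal_law mu L.
Variable f : R -> R.

(* The recursion runs along the tail, so that [walk_max n s] is the maximum of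
   the partial sums [f (s 0) + ... + f (s i.-1)], [i <= n]. *)
Fixpoint walk_max (n : nat) (s : seq_space R) : R :=
  if n is n'.+1 then Num.max 0 (f (s 0%N) + walk_max n' (seq_tail s)) else 0.

Lemma walk_max_ge0 n s : 0 <= walk_max n s.
Proof. by case: n => //= n; rewrite le_max lexx. Qed.

Lemma walk_max_le n s : walk_max n s <= walk_max n.+1 s.
Proof.
elim: n s => [|n IH] s; first exact: walk_max_ge0.
rewrite [leRHS]/= [leLHS]/= ge_max !le_max lexx/=.
by rewrite lerD2l IH orbT.
Qed.

Lemma sum_le_walk_max n (s : seq_space R) :
  \sum_(i < n) f (s i) <= walk_max n s.
Proof.
elim: n s => [|n IH] s; first by rewrite big_ord0.
by rewrite big_ord_recl /= le_max lerD2l (IH (seq_tail s)) orbT.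
Qed.

Lemma nondecreasing_walk_max s : nondecreasing_seq (walk_max ^~ s).
Proof. by apply/nondecreasing_seqP => n; exact: walk_max_le. Qed.

Hypothesis intf : mu.-integrable [set: R] (EFin \o f).

Let mf : measurable_fun [set: R] f.
Proof. by apply/measurable_EFinP; exact: measurable_int intf. Qed.

Lemma measurable_walk_max n : measurable_fun [set: seq_space R] (walk_max n).
Proof.
elim: n => [|n IH] //=; apply: measurable_maxr => //.
apply: measurable_funD; first exact: (measurableT_comp mf (measurable_coord 0)).
exact: (measurableT_comp IH measurable_seq_tail).
Qed.

Definition walk_unbounded : set (seq_space R) :=
  \bigcap_k \bigcup_n [set s | k%:R < walk_max n s].

Lemma measurable_walk_unbounded : measurable walk_unbounded.
Proof.
apply: bigcapT_measurable => k; apply: bigcupT_measurable => n.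
rewrite -[X in measurable X]setTI.
by apply: measurable_fun_ltr => //; exact: measurable_walk_max.
Qed.

(** Adding a head [x] shifts all later partial sums by the finite amount [f x]; the level
    [|f x| + k] absorbs this shift in both directions. *)
Lemma walk_unbounded_cons :
  seq_cons @^-1` walk_unbounded = snd @^-1` walk_unbounded.
Proof.
apply/seteqP; split=> -[x s] /= h k _.
- have [n _] := h (Num.truncn (`|f x| + k%:R)).+1 I.
  case: n => [|n] /=; first by rewrite ltNge ler0n.
  have fk : 0 <= `|f x| + k%:R by rewrite addr_ge0.
  have {fk} := truncnS_gt (`|f x| + k%:R).
  move=> trunc_gt; rewrite /seq_cons/= lt_max ltNge ler0n/= => lt_walk.
  exists n => //=; have := ler_norm (f x); lra.
- have [n _ /= lt_walk] := h (Num.truncn (`|f x| + k%:R)).+1 I.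
  exists n.+1 => //=; rewrite lt_max; apply/orP; right.
  have := truncnS_gt (`|f x| + k%:R).
  have := ler_norm (- f x); rewrite normrN [f _]/= [walk_max n _]/=.
  rewrite /seq_tail /seq_cons/=; lra.
Qed.

Let measurable_walk_cons n :
  measurable_fun [set: R * seq_space R] (fun u => f u.1 + walk_max n u.2).
Proof.
apply: measurable_funD; first exact: measurableT_comp.
by apply: (measurableT_comp (measurable_walk_max n)); exact: measurable_snd.
Qed.

Let preserving_snd (A : set (seq_space R)) :
  measurable A -> (mu \x L)%E (snd @^-1` A) = L A.
Proof. exact: product_measure_snd. Qed.

Let integrable_head : (mu \x L)%E.-integrable setT (fun u => (f u.1)%:E).
Proof.
exact: (preserving_integrable measurable_fst
  (@product_measure_fst _ _ _ _ _ mu L) measurableT intf).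
Qed.

(** After concatenation, the maximum at rank n+1 is at most |f + M_n|, integrable by induction. *)
Lemma integrable_walk_max n :
  L.-integrable [set: seq_space R] (EFin \o walk_max n).
Proof.
elim: n => [|n IH].
  by apply: (eq_integrable _ (cst 0%E)) => //; exact: integrable0.
have int2 : (mu \x L)%E.-integrable setT (fun u => (walk_max n u.2)%:E).
  exact: (preserving_integrable measurable_snd preserving_snd measurableT IH).
apply/integrableP; split.
  by apply/measurable_EFinP; exact: measurable_walk_max.
under eq_integral do rewrite gee0_abs ?lee_fin ?walk_max_ge0//.
rewrite (preserving_ge0_integral measurable_seq_cons renL measurableT);
  first last.
- by move=> s _; rewrite lee_fin walk_max_ge0.
- by apply/measurable_EFinP; exact: measurable_walk_max.
rewrite preimage_setT.
have /integrableP[_] := integrableD measurableT integrable_head int2.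
apply: le_lt_trans; apply: ge0_le_integral => //.
- by move=> u _; rewrite lee_fin walk_max_ge0.
- apply/measurable_EFinP; apply: (measurableT_comp (measurable_walk_max n.+1)).
  exact: measurable_seq_cons.
- apply: measurableT_comp => //; apply/measurable_EFinP.
  exact: measurable_walk_cons.
move=> [x s] _ /=; rewrite lee_fin.
by rewrite ge_max normr_ge0/= ler_norm.
Qed.

(* Garsia: on the event that the walk is unbounded, which does not depend on the
   head, M_n.+1 - M_n averages to max (- M_n) f, which tends to f. *)
Lemma walk_bounded_ae : (\int[mu]_x (f x)%:E < 0)%E -> L walk_unbounded = 0%E.
Proof.
move=> f_lt0; set A := walk_unbounded.
have mA : measurable A by exact: measurable_walk_unbounded.
pose D : set (R * seq_space R) := snd @^-1` A.
have mD : measurable D.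
  by rewrite -[D]setTI; exact: measurable_snd.
(* The increment M_n.+1 (x, s) - M_n (s), equal to max (- M_n) f. *)
pose h n (u : R * seq_space R) :=
  Num.max 0 (f u.1 + walk_max n u.2) - walk_max n u.2.
have int_walk n : (mu \x L)%E.-integrable D (fun u => (walk_max n u.2)%:E).
  apply: (@integrableS _ _ _ _ setT) => //.
  exact: (preserving_integrable measurable_snd preserving_snd measurableT
    (integrable_walk_max n)).
have int_cons n : (mu \x L)%E.-integrable D
    (fun u => (Num.max 0 (f u.1 + walk_max n u.2))%:E).
  apply: (@integrableS _ _ _ _ setT) => //.
  exact: (preserving_integrable measurable_seq_cons renL measurableT
    (integrable_walk_max n.+1)).
have h_ge0 n : (0 <= \int[mu \x L]_(u in D) (h n u)%:E)%E.
  have mw k : measurable_fun A (fun s => (walk_max k s)%:E).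
    apply: measurable_funTS; apply/measurable_EFinP.
    exact: measurable_walk_max.
  have w0 k s : A s -> (0 <= (walk_max k s)%:E)%E.
    by move=> _; rewrite lee_fin walk_max_ge0.
  (* The event has the same preimage under concatenation and under the second projection, so the
     integral of [h n] over [D] is that of M_n.+1 - M_n over [A], hence nonnegative. *)
  have E1 :=
    preserving_ge0_integral measurable_snd preserving_snd mA (mw n) (w0 n).
  have E2 :=
    preserving_ge0_integral measurable_seq_cons renL mA (mw n.+1) (w0 n.+1).
  rewrite walk_unbounded_cons -/A -/D in E2.
  have le_int : (\int[L]_(s in A) (walk_max n s)%:E <=
      \int[L]_(s in A) (walk_max n.+1 s)%:E)%E.
    apply: ge0_le_integral => // [s|s _]; first exact: w0.
    by rewrite lee_fin walk_max_le.
  have fin_int : (\int[L]_(s in A) (walk_max n s)%:E)%E \is a fin_num.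
    apply: integrable_fin_num => //.
    by apply: integrableS (integrable_walk_max n).
  under eq_integral do rewrite EFinB.
  rewrite (integralB_EFin mD (int_cons n) (int_walk n)).
  move: le_int; rewrite E2 E1 => le_int; rewrite E1 in fin_int.
  by rewrite sube_ge0 ?fin_int.
have cvg_h u : D u -> (h n u)%:E @[n --> \oo] --> (f u.1)%:E.
  (* Once M_n exceeds |f|, the maximum defining [h] is its second argument and [h] equals f
     exactly. *)
  move=> Du; apply: cvg_near_cst.
  have [N _ /= ltN] := Du (Num.truncn `|f u.1|).+1 I.
  exists N => // k /= leNk; congr EFin; rewrite /h.
  have := nondecreasing_walk_max u.2 leNk.
  have := truncnS_gt `|f u.1|; have := ler_norm (- f u.1); rewrite normrN => *.
  by rewrite max_r; lra.
(* Domination: since M_k >= 0, max (- M_k) f lies between - |f| and |f|. *)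
have h_le u k : D u -> (`|(h k u)%:E| <= `|(f u.1)%:E|)%E.
  move=> _; rewrite lee_fin /h; have := walk_max_ge0 k u.2.
  have := ler_norm (f u.1); have := ler_norm (- f u.1); rewrite normrN => ? ? ?.
  by rewrite ler_norml; case: (leP 0 (f u.1 + walk_max k u.2)) => ?; lra.
have mh n : measurable_fun D (fun u => (h n u)%:E).
  apply: measurable_funTS; apply/measurable_EFinP; apply: measurable_funB.
    by apply: measurable_maxr => //; exact: measurable_walk_cons.
  by apply: (measurableT_comp (measurable_walk_max n)); exact: measurable_snd.
have int_head : (mu \x L)%E.-integrable D (fun u => (f u.1)%:E).
  exact: (@integrableS _ _ _ _ setT).
have [_ _ cvg_int] := dominated_convergence mD mh (measurable_int _ int_head)
  (aeW _ cvg_h) (integrable_abse int_head) (aeW _ h_le).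
have : (0 <= \int[mu \x L]_(u in D) (f u.1)%:E)%E.
  by apply: cvge_ge cvg_int; exact: nearW.
(* The limit is the mean of f, which is negative, times [L A]; its nonnegativity forces [L A] to
   vanish. *)
rewrite (@integral_fst_strip _ _ _ _ _ mu L _ _ mA intf) (nmule_rge0 _ f_lt0).
move=> LA_le0.
by apply/eqP; rewrite eq_le LA_le0 measure_ge0.
Qed.
End random_walk.

(** * Almost sure inclusion, and laws compared on open sets *)

Section measure_facts.
Local Open Scope ereal_scope.

Lemma le_measure_ae d (X : measurableType d) (R : realType)
    (m : {measure set X -> \bar R}) (A B : set X) :
  measurable A -> measurable B -> {ae m, forall x, A x -> B x} -> m A <= m B.
Proof.
move=> mA mB [N [mN N0 subN]]; rewrite -(measureU0 mB mN N0).
apply: le_measure; rewrite ?inE//; first exact: measurableU.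
move=> x Ax; have [Bx|Bx] := pselect (B x); [by left|right].
by apply: subN => /(_ Ax).
Qed.

Lemma ae_preserving d d' (X : measurableType d) (Y : measurableType d')
    (R : realType) (m : {measure set X -> \bar R})
    (m' : {measure set Y -> \bar R}) (phi : X -> Y) (Q : Y -> Prop) :
  measurable_fun [set: X] phi ->
  (forall A, measurable A -> m (phi @^-1` A) = m' A) ->
  {ae m', forall y, Q y} -> {ae m, forall x, Q (phi x)}.
Proof.
move=> mphi phiE [N [mN N0 subN]]; exists (phi @^-1` N); split.
- by rewrite -[_ @^-1` _]setTI; exact: mphi.
- by rewrite phiE.
- by move=> x; exact: subN.
Qed.

(** Taking complements reverses the inequality on closed sets. An open ray is an increasing union of
    closed rays, so both inequalities hold on open rays, which form a generating pi-system. *)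
Lemma probability_eq_open (R : realType) (m1 m2 : probability R R) :
  (forall U, open U -> m1 U <= m2 U) ->
  forall A, measurable A -> m1 A = m2 A.
Proof.
move=> le12 A mA.
have le21 F : closed F -> m2 F <= m1 F.
  move=> cF; have mF := closed_measurable cF.
  have := le12 _ (closed_openC cF).
  rewrite !probability_setC//.
  rewrite -(fineK (fin_num_measure m1 F mF)) -(fineK (fin_num_measure m2 F mF)).
  by rewrite -!EFinB !lee_fin; lra.
apply: (@g_sigma_algebra_measure_unique _ R R (@RGenOInfty.G R) _
  (fun n => `]- n%:R, +oo[%classic)%R _ _ m1 m2) => //.
- by move=> _ [x ->].
- by move=> n; exists (- n%:R)%R.
- apply/seteqP; split=> // x _; exists (Num.truncn `|x|).+1 => //=.
  rewrite in_itv/= andbT; have := truncnS_gt `|x|%R.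
  have := ler_norm (- x)%R; rewrite normrN; lra.
- move=> _ _ [x ->] [y ->]; exists (Num.max x y).
  by apply/seteqP; split => z /=; rewrite !in_itv/= !andbT gt_max => /andP.
- move=> _ [x ->]; apply/eqP; rewrite eq_le le12; last by apply: rray_open.
  rewrite itvoyEbigcup.
  pose F (k : nat) : set R := `[(x + k.+1%:R^-1)%R, +oo[%classic.
  have mF k : measurable (F k) by exact: measurable_itv.
  have ndF : {homo F : n m / (n <= m)%N >-> (n <= m)%O}.
    move=> i j leij; apply/subsetPset => z; rewrite /F/= !in_itv/= !andbT.
    apply: le_trans; rewrite lerD2l lef_pV2 ?posrE// ler_nat ltnS//.
  have mUF : measurable (\bigcup_k F k) by exact: bigcupT_measurable.
  have c1 := nondecreasing_cvg_mu (mu := m1) mF mUF ndF.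
  have c2 := nondecreasing_cvg_mu (mu := m2) mF mUF ndF.
  rewrite -(cvg_lim _ c1)// -(cvg_lim _ c2)//; apply: lee_lim.
  - by apply/cvg_ex; eexists; exact: c2.
  - by apply/cvg_ex; eexists; exact: c1.
  - by apply: nearW => k; apply: le21; exact: rray_closed.
- by move=> k; apply: le_lt_trans (ltry 1); exact: probability_le1.
- have := RGenOInfty.measurableE R; rewrite /measurable/= => <-; exact: mA.
Qed.

End measure_facts.

(** * Affine maps, their backward iterations and the limit *)

Section affine_recursion.
Context {R : realType}.
Implicit Types (s : seq_space R).

Lemma measurable_invr : measurable_fun [set: R] (@GRing.inv R).
Proof.
have oD : open [set x : R | x != 0] by exact: open_neq.
have -> : [set: R] = [set x | x != 0] `|` [set 0].
  by apply/seteqP; split=> // x _; have [->|x0] := eqVneq x 0; [right|left].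
apply/measurable_funU => //; first exact: open_measurable.
split; last exact: measurable_fun_set1.
apply: open_continuous_measurable_fun => // x; rewrite inE => /= x0.
exact: inv_continuous.
Qed.

Lemma measurable_affine_step :
  measurable_fun [set: R * R] (fun u => affine_step u.1 u.2).
Proof.
have mV : measurable_fun [set: R * R] (fun u => u.1^-1).
  by apply: (measurableT_comp measurable_invr); exact: measurable_fst.
rewrite /affine_step; apply: measurable_funD => //.
apply: measurable_funM; last exact: measurable_snd.
under eq_fun do rewrite -exprVn.
exact: measurable_funX.
Qed.

Lemma affine_stepE (a x : R) : affine_step a x = a^-1 ^+ 2 * x + a^-1.
Proof. by rewrite /affine_step exprVn. Qed.

(** The map of [s 0] is outermost, so a further step changes only the innermost map; this order lets
    paths converge, unlike the forward order of [Ntilde_inv]. *)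
Fixpoint backward (n : nat) s (y : R) : R :=
  if n is n'.+1 then affine_step (s 0%N) (backward n' (seq_tail s) y) else y.

Lemma measurable_backward n :
  measurable_fun [set: seq_space R * R] (fun u => backward n u.1 u.2).
Proof.
elim: n => [|n IH]; first exact: measurable_snd.
have mhead : measurable_fun [set: seq_space R * R] (fun u => u.1 0%N).
  by apply: (measurableT_comp (measurable_coord 0)); exact: measurable_fst.
have mtail : measurable_fun [set: seq_space R * R] (fun u => seq_tail u.1).
  by apply: (measurableT_comp measurable_seq_tail); exact: measurable_fst.
have mback := measurableT_comp IH (measurable_fun_pair mtail measurable_snd).
exact: (measurableT_comp measurable_affine_step
  (measurable_fun_pair mhead mback)).
Qed.

Lemma Nsum_cons s n : Nsum s n.+1 = affine_step (s 0%N) (Nsum (seq_tail s) n).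
Proof.
rewrite /Nsum big_nat_recl// big_geq// expr1n mulr1 affine_stepE addrC.
congr (_ + _); rewrite mulr_sumr; apply: eq_bigr => k _.
by rewrite big_nat_recl// exprMn /seq_tail; ring.
Qed.

Lemma backwardE n s y :
  backward n s y = Nsum s n + (\prod_(i < n) (s i)^-1) ^+ 2 * y.
Proof.
elim: n s => [|n IH] s.
  by rewrite /Nsum big_geq// big_ord0 add0r expr1n mul1r.
rewrite [LHS]/= IH Nsum_cons big_ord_recl !affine_stepE /seq_tail/=.
by rewrite exprMn; ring.
Qed.

Lemma measurable_Nsum n : measurable_fun [set: seq_space R] (fun s => Nsum s n).
Proof.
rewrite (_ : (fun s => _) = (fun s => backward n s 0)); last first.
  by apply/funext => s; rewrite backwardE mulr0 addr0.
have mid : measurable_fun [set: seq_space R] (fun s => s) by [].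
have m0 : measurable_fun [set: seq_space R] (fun=> 0 : R) by [].
exact: (measurableT_comp (measurable_backward n) (measurable_fun_pair mid m0)).
Qed.

Lemma Ntilde_inv_recr (u : nat -> R) n :
  Ntilde_inv u n.+1 = affine_step (u n) (Ntilde_inv u n).
Proof.
rewrite /Ntilde_inv big_nat_recr//= [\prod_(n.+1 <= j < n.+1) _]big_geq//.
rewrite expr1n mulr1 affine_stepE.
congr (_ + _); rewrite mulr_sumr !big_seq; apply: eq_bigr => k.
rewrite mem_index_iota => /andP[_ ltkn].
by rewrite big_nat_recr//= exprMn; ring.
Qed.

(* By [backwardE], the second condition makes the backward iterations forget
   their starting point. *)
Definition contracting s :=
  cvgn (Nsum s) /\ (\prod_(i < n) (s i)^-1) @[n --> \oo] --> 0.

(** An upper limit in the extended reals is measurable on all sequences and agrees with the limit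
    when [Nsum s] converges; [fine] sends infinite values to 0. *)
Definition perpetuity s : R := fine (limn_esup (fun n => (Nsum s n)%:E)).

Lemma measurable_perpetuity : measurable_fun [set: seq_space R] perpetuity.
Proof.
apply: (measurableT_comp (fine_measurable measurableT)).
apply: measurable_fun_limn_esup => n; apply/measurable_EFinP.
exact: measurable_Nsum.
Qed.

HB.instance Definition _ :=
  isMeasurableFun.Build _ _ _ _ perpetuity measurable_perpetuity.

Lemma perpetuityE s l : Nsum s @ \oo --> l -> perpetuity s = l.
Proof.
move=> sl; rewrite /perpetuity.
have sl_EFin : (Nsum s n)%:E @[n --> \oo] --> l%:E.
  by apply: cvg_EFin => //; exact: nearW.
by have [_ ->] := cvg_limn_einf_sup sl_EFin.
Qed.

Lemma perpetuity_lim s : cvgn (Nsum s) -> perpetuity s = limn (Nsum s).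
Proof. exact: perpetuityE. Qed.

Lemma perpetuity_cons x s : cvgn (Nsum s) ->
  perpetuity (seq_cons (x, s)) = affine_step x (perpetuity s).
Proof.
move=> cs; apply: perpetuityE; rewrite (perpetuity_lim cs) affine_stepE.
rewrite -cvg_shiftS.
under eq_fun do rewrite Nsum_cons affine_stepE seq_tail_cons/=.
by apply: cvgD; [apply: cvgM => //; exact: cvg_cst|exact: cvg_cst].
Qed.

Lemma backward_cvg s y : contracting s ->
  backward n s y @[n --> \oo] --> perpetuity s.
Proof.
move=> [cs p0]; under eq_fun do rewrite backwardE.
rewrite -[perpetuity s]addr0 -[X in _ + X](mul0r y) (perpetuity_lim cs).
apply: cvgD => //; apply: cvgM; last exact: cvg_cst.
by rewrite -(mulr0 0); under eq_fun do rewrite expr2; exact: cvgM.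
Qed.

(** The bound on the walk says that the product of the first n inverses is at most exp K * exp (- c)
    ^ n, so the terms of [Nsum] decay geometrically. *)
Lemma contracting_of_drift s c : (forall i, 0 < s i) -> 0 < c ->
  (exists K, forall n, \sum_(i < n) (c - ln (s i)) <= K) -> contracting s.
Proof.
move=> s_gt0 c_gt0 [K leK].
pose p n := \prod_(i < n) (s i)^-1.
pose q := expR (- c).
have q_gt0 : 0 < q by exact: expR_gt0.
have q_lt1 : q < 1 by rewrite expR_lt1 oppr_lt0.
have p_gt0 n : 0 < p n by apply: prodr_gt0 => i _; rewrite invr_gt0.
have p_le n : p n <= expR K * q ^+ n.
  rewrite -expRM_natl -expRD.
  have -> : p n = expR (\sum_(i < n) - ln (s i)).
    rewrite expR_sum; apply: eq_bigr => i _.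
    by rewrite expRN lnK// posrE.
  rewrite ler_expR; have := leK n.
  by rewrite big_split/= sumr_const card_ord -mulr_natl; lra.
split; last first.
  apply: (squeeze_cvgr (f := fun=> 0) (h := fun n => expR K * q ^+ n)).
  - by apply: nearW => n; apply/andP; split; [exact: ltW (p_gt0 n)|exact: p_le].
  - exact: cvg_cst.
  - rewrite -[0](mulr0 (expR K)); apply: cvgM; first exact: cvg_cst.
    by apply: cvg_expr; rewrite ger0_norm// ltW.
(* One factor of the square absorbs [(s k)^-1], turning [p k] into [p k.+1]. *)
have -> : Nsum s = series (fun k => p k * p k.+1).
  apply/funext => n; rewrite /Nsum /series/=; apply: eq_bigr => k _.
  by rewrite big_mkord /p big_ord_recr/=; ring.
(* The constants come from multiplying the bounds on [p n] and [p n.+1]. *)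
apply: (@series_le_cvg _ _ (geometric (expR K ^+ 2 * q) (q ^+ 2))).
- by move=> n; rewrite mulr_ge0 ?ltW.
- by move=> n; rewrite /geometric/= !mulr_ge0 ?exprn_ge0// ?expR_ge0// ltW.
- move=> n; rewrite /geometric/=.
  rewrite [leRHS](_ : _ = (expR K * q ^+ n) * (expR K * q ^+ n.+1)); last first.
    by rewrite -exprM mul2n -addnn exprD [q ^+ n.+1]exprS; ring.
  by apply: ler_pM; first [exact: p_le|exact: ltW (p_gt0 _)].
apply: is_cvg_geometric_series.
by rewrite normrX ger0_norm ?ltW// expr_lt1 ?ltW.
Qed.

End affine_recursion.

(** * Existence and uniqueness of the invariant law *)

Section invariant_measure.
Context {R : realType} (mu : probability R R) (L : probability (seq_space R) R).
Hypothesis renL : renewal_law mu L.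
Hypothesis conL : {ae L, forall s, contracting s}.

(** Concatenating an independent head preserves [L] and acts on the perpetuity as the affine map of
    that head. *)
Lemma perpetuity_invariant A : measurable A ->
  pushforward (mu \x distribution L perpetuity)%E
    (fun u => affine_step u.1 u.2) A = distribution L perpetuity A.
Proof.
move=> mA.
have mB := measurable_preimage measurable_affine_step mA.
set B := _ @^-1` A in mB.
have mperp : measurable_fun [set: R * seq_space R] (fun u => perpetuity u.2).
  exact: (measurableT_comp measurable_perpetuity measurable_snd).
have mC : measurable [set u : R * seq_space R | B (u.1, perpetuity u.2)].
  exact: (measurable_preimage (measurable_fun_pair measurable_fst mperp)).
transitivity ((mu \x L)%E [set u | B (u.1, perpetuity u.2)]).
  apply: eq_integral => x _.
  rewrite [LHS]/= [RHS]/= /distribution /pushforward; congr (L _).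
have mpA : measurable (perpetuity @^-1` A).
  exact: (measurable_preimage measurable_perpetuity).
rewrite [RHS]/distribution [RHS]/pushforward -(renL mpA).
(* The tail is almost surely contracting, so [perpetuity_cons] identifies the two events up to a
   null set. *)
have aeC : {ae (mu \x L)%E, forall u : R * seq_space R, contracting u.2}.
  apply: (ae_preserving measurable_snd _ conL) => ? ?.
  exact: product_measure_snd.
apply/eqP; rewrite eq_le; apply/andP; split; apply: le_measure_ae => //.
- exact: (measurable_preimage measurable_seq_cons).
- by apply: filterS aeC => -[x s] [cs _]; rewrite /B /= perpetuity_cons.
- exact: (measurable_preimage measurable_seq_cons).
- by apply: filterS aeC => -[x s] [cs _]; rewrite /B /= perpetuity_cons.
Qed.

Section uniqueness.
Variable nu : probability R R.
Hypothesis nu_invariant : forall A, measurable A ->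
  pushforward (mu \x nu)%E (fun u => affine_step u.1 u.2) A = nu A.

(** With the head fixed, the inner n iterations have law [nu] by induction; the outer map, with an
    independent head of law [mu], preserves [nu]. *)
Lemma backward_law n A : measurable A ->
  (L \x nu)%E [set u | A (backward n u.1 u.2)] = nu A.
Proof.
elim: n A => [|n IH] A mA; first exact: product_measure_snd.
have mB := measurable_preimage measurable_affine_step mA.
set B := _ @^-1` A in mB.
have mD k (C : set R) : measurable C ->
    measurable [set u : seq_space R * R | C (backward k u.1 u.2)].
  exact: (measurable_preimage (measurable_backward k)).
have mg := measurable_fun_xsection nu (mD n.+1 _ mA).
rewrite -(nu_invariant mA) [LHS]/product_measure1.
rewrite (preserving_ge0_integral measurable_seq_cons renL measurableT mg)//.
rewrite preimage_setT fubini_tonelli1//; last first.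
  exact: (measurableT_comp mg measurable_seq_cons).
apply: eq_integral => x _; rewrite /fubini_F [RHS]/=.
have mBx : measurable (xsection B x) by exact: measurable_xsection.
rewrite -(IH _ mBx); apply: eq_integral => s _.
rewrite [LHS]/= [RHS]/=; congr (nu _).
by apply/seteqP; split=> y; rewrite /xsection/= !inE/= ?inE.
Qed.

(* Portmanteau: backward iterations all have law [nu], and converge almost
   surely to the perpetuity. *)
Lemma perpetuity_open_le U : open U -> (distribution L perpetuity U <= nu U)%E.
Proof.
move=> oU; have mU := open_measurable oU.
pose E n := [set u : seq_space R * R | U (backward n u.1 u.2)].
have mE n : measurable (E n).
  exact: (measurable_preimage (measurable_backward n)).
(* All iterations from rank n on lie in [U]. The union of these events is the lower limit of the
   [E n]. *)
pose F n := \bigcap_(m in [set m | (n <= m)%N]) E m.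
have mF n : measurable (F n).
  by apply: bigcap_measurableType => // m _; exact: mE.
have mUF : measurable (\bigcup_n F n) by exact: bigcupT_measurable.
have ndF : {homo F : n m / (n <= m)%N >-> (n <= m)%O}.
  move=> i j leij; apply/subsetPset => u Fu m /= lejm.
  by apply: Fu; exact: leq_trans lejm.
have cvgF := nondecreasing_cvg_mu (mu := (L \x nu)%E) mF mUF ndF.
have mpU := measurable_preimage measurable_perpetuity mU.
apply: (@le_trans _ _ ((L \x nu)%E (\bigcup_n F n))).
  rewrite [leLHS](esym (product_measure_fst L nu mpU)).
  have mfU := measurable_preimage measurable_fst mpU.
  apply: le_measure_ae => //.
  have aeC : {ae (L \x nu)%E, forall u : seq_space R * R, contracting u.1}.
    apply: (ae_preserving measurable_fst _ conL) => ? ?.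
    exact: product_measure_fst.
  apply: filterS aeC => -[s y] cs /= Us.
  (* Openness of [U]: a limit in [U] keeps the iterations in [U] from some rank on. *)
  have [N _ subN] := backward_cvg y cs (open_nbhs_nbhs (conj oU Us)).
  by exists N => // m /= leNm; exact: subN.
rewrite -(cvg_lim _ cvgF)//; apply: lime_le.
  by apply/cvg_ex; eexists; exact: cvgF.
(* Each [F n] is contained in [E n], whose mass is exactly [nu U]. *)
apply: nearW => n /=; rewrite -(backward_law n mU).
apply: le_measure; [by apply: mem_set; exact: mF|by apply: mem_set; exact: mE|].
by move=> u Fu; exact: (Fu n (leqnn n)).
Qed.

End uniqueness.
End invariant_measure.

(** * Convergence and identification of the limit law *)

Theorem proposition5p2 (d : measure_display) (T : measurableType d)
    (R : realType) (P : probability T R) (gamma : nat -> {RV P >-> R})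
    (gamma_gt0 : forall i, {ae P, forall w, 0 < gamma i w})
    (gamma_iid : iid gamma)
    (ln_int : P.-integrable [set: T] (fun w => (ln (gamma 0%N w))%:E))
    (ln_mean : (0 < 'E_P[(fun w => ln (gamma 0%N w))])%E)
    (g0_spread_out : spread_out (distribution P (gmat_rv (gamma 0%N)))) :
  {ae P, forall w, cvgn (Nsum (fun i => gamma i w))} /\
  driven_by affine_step gamma (fun n w => Ntilde_inv (fun i => gamma i w) n) /\
  exists Ninf : {RV P >-> R},
    {ae P, forall w, Ninf w = limn (Nsum (fun i => gamma i w))} /\
    unique_invariant_law affine_step (gamma 0%N) (distribution P Ninf).
Proof.
set mu := distribution P (gamma 0%N).
pose L := distribution P (sample_path gamma).
have renL : renewal_law mu L by exact: iid_renewal.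
have pathE A : measurable A -> P (sample_path gamma @^-1` A) = L A by [].
have L_gt0 i : {ae L, forall s : seq_space R, 0 < s i}.
  have mpos : measurable [set s : seq_space R | 0 < s i].
    rewrite -[X in measurable X]setTI.
    by apply: measurable_fun_ltr => //; exact: measurable_coord.
  apply/negligibleP; first exact: measurableC.
  have := gamma_gt0 i; rewrite /almost_everywhere/=.
  move/negligibleP; apply.
  exact: (measurable_preimage (measurable_sample_path gamma) (measurableC mpos)).
pose m := fine ('E_P[(fun w => ln (gamma 0%N w))])%E.
have mE : ('E_P[(fun w => ln (gamma 0%N w))] = m%:E)%E.
  by rewrite /m fineK// unlock; exact: integrable_fin_num.
have m_gt0 : 0 < m by rewrite -lte_fin -mE.
have int_ln : mu.-integrable [set: R] (fun x => (ln x)%:E).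
  apply: (integrable_pushforward (measurable_funP (gamma 0%N))) => //.
  by apply/measurable_EFinP; exact: measurable_ln.
have E_ln : (\int[mu]_x (ln x)%:E = m%:E)%E.
  rewrite integral_distribution//; last first.
    by apply/measurable_EFinP; exact: measurable_ln.
  by rewrite -mE unlock.
(* Any drift strictly between 0 and [m] would do: the mean of f is - m / 2, and a rate c = m / 2 is
   left for the contraction. *)
pose f x := m / 2 - ln x.
have int_f : mu.-integrable [set: R] (EFin \o f).
  apply: (eq_integrable measurableT (fun x => (m / 2)%:E - (ln x)%:E)%E) => //.
  by apply: integrableB => //; exact: finite_measure_integrable_cst.
have f_lt0 : (\int[mu]_x (f x)%:E < 0)%E.
  have int_cst : mu.-integrable [set: R] (EFin \o (fun=> m / 2)).
    exact: finite_measure_integrable_cst.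
  have E_cst : (\int[mu]_x ((fun=> m / 2) x)%:E = (m / 2)%:E)%E.
    rewrite (integral_cst mu measurableT (m / 2)%:E).
    by rewrite [X in (_ * X)%E](probability_setT mu) mule1.
  under eq_integral do rewrite EFinB.
  rewrite (integralB_EFin measurableT int_cst int_ln) E_cst E_ln.
  by rewrite -EFinB lte_fin; lra.
have L_bounded := walk_bounded_ae renL int_f f_lt0.
have conL : {ae L, forall s, contracting s}.
  have aeB : {ae L, forall s, ~ walk_unbounded f s}.
    exists (walk_unbounded f); split => //; last by move=> s /= /contrapT.
    exact: measurable_walk_unbounded int_f.
  apply: filterS2 (ae_foralln L_gt0) aeB => s s_gt0 bounded_s.
  apply: (@contracting_of_drift _ s (m / 2) s_gt0); first by rewrite divr_gt0.
  (* Without a common bound on the partial sums, every level k is exceeded by some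
     [walk_max n s]. *)
  apply: contrapT => unb; apply: bounded_s => k _; apply: contrapT => nk.
  apply: unb; exists k%:R => n; apply: le_trans (sum_le_walk_max f n s) _.
  by rewrite leNgt; apply/negP => lt_k; apply: nk; exists n.
have conP : {ae P, forall w, contracting (sample_path gamma w)}.
  exact: (ae_preserving (measurable_sample_path gamma) pathE conL).
split; first by apply: filterS conP => w [].
split; first by move=> n w _; exact: Ntilde_inv_recr.
pose Ninf : {RV P >-> R} := perpetuity \o sample_path gamma.
exists Ninf; split.
  by apply: filterS conP => w [cs _]; exact: perpetuity_lim.
split=> [A mA|nu inv_nu A mA]; first exact: (perpetuity_invariant renL conL mA).
(* Between probabilities, the one-sided inequality on open sets already gives equality. *)
apply/esym; move: A mA; apply: probability_eq_open => U oU.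
exact: (perpetuity_open_le renL conL inv_nu oU).
Qed.
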